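(* Let $M$ be a rationally supported submonoid of $(\mathbb{Z}^2,+)$. If $M$ is nearly atomic, then $M$ is atomic.
   Context: Let $M$ be a submonoid of $(\mathbb{Z}^2,+)$. $\mathcal{U}(M)$ denotes the group of invertible elements of $M$. An element $a\in M\setminus\mathcal{U}(M)$ is an atom if whenever $a=r+s$ with $r,s\in M$, either $r\in\mathcal{U}(M)$ or $s\in\mathcal{U}(M)$. A non-invertible element of $M$ is atomic if it is a finite sum of atoms of $M$. $M$ is atomic if every non-invertible element of $M$ is atomic. $M$ is nearly atomic if there exists $b\in M$ such that $b+m$ is atomic for all $m\in M$. A supporting line of $M$ is a line through the origin of $\mathbb{R}^2$ such that $M$ is contained in one of the two closed half-planes determined by that line. $M$ is rationally supported if it has a supporting line with rational slope. *)

(* Defs.v *)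
From mathcomp Require Import all_boot all_order all_algebra.
From mathcomp Require Import boolp classical_sets reals.

Set Implicit Arguments.
Unset Strict Implicit.
Unset Printing Implicit Defensive.
Import Order.TTheory GRing.Theory Num.Theory.
Local Open Scope classical_set_scope.
Local Open Scope ring_scope.

Section Atomicity.
Variable V : nmodType.
Implicit Types M : set V.

Definition submonoid M : Prop := GRing.nmod_closed (mem M).

Definition invertibles M : set V :=
  [set x | M x /\ exists2 y, M y & x + y = 0].

Definition atoms M : set V :=
  [set a | [/\ M a, ~ invertibles M a &
    forall r s, M r -> M s -> a = r + s ->
      invertibles M r \/ invertibles M s]].

(* As only non-invertible elements can be atomic, the empty sum of atoms
   (which is the invertible element 0) is excluded. *)
Definition atomic_elements M : set V :=
  [set x | [/\ M x, ~ invertibles M x &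
    exists2 s : seq V, (forall a, a \in s -> atoms M a) &
      x = \sum_(a <- s) a]].

Definition atomic M : Prop :=
  forall x, M x -> ~ invertibles M x -> atomic_elements M x.

Definition nearly_atomic M : Prop :=
  exists2 b, M b & forall m, M m -> atomic_elements M (b + m).

End Atomicity.

Section RationalSupport.
Variable R : realType.
Implicit Types (M : set (int * int)) (L : set (R * R)).

Definition real_points M : set (R * R) :=
  [set (p.1%:~R, p.2%:~R) | p in M].

Definition supporting_line M L : Prop :=
  exists a b : R, [/\ (a, b) != (0, 0),
    L = [set p | a * p.1 + b * p.2 = 0] &
    real_points M `<=` [set p | 0 <= a * p.1 + b * p.2] \/
    real_points M `<=` [set p | a * p.1 + b * p.2 <= 0]].

(* The vertical axis counts as having the rational slope 1/0, so that the
   notion is invariant under the automorphisms of Z^2. *)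
Definition rational_slope L : Prop :=
  L = [set p | p.1 = 0] \/
  exists q : rat, L = [set p | p.2 = ratr q * p.1].

Definition rationally_supported M : Prop :=
  exists2 L, supporting_line M L & rational_slope L.

End RationalSupport.

(* Main.v *)
Require Import Defs.
From HB Require Import structures.
From mathcomp Require Import all_boot all_order all_algebra.
From mathcomp Require Import boolp classical_sets reals.
From mathcomp Require Import zify ring lra.

(** The rational slope of the supporting line yields an integer linear form
    [f] that is nonnegative on [M]; a second integer form [g], orthogonal to
    [f], provides a coordinate along the lines on which [f] is constant.  Since
    [f] is additive and nonnegative on [M], a summand of an element of height
    [f x = 0] also has height [0].

    If every element of height [0] is invertible, then [f] is positive on the
    noninvertible elements, so that a noninvertible [x] splits into at most
    [f x] noninvertible summands and [M] is atomic without further assumption.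

    Otherwise some [u] in [M] of height [0] is not invertible, with [0 < g u]
    after possibly changing the sign of [g].  An element of height [0] with
    [g < 0] would make [u] invertible ([height0_ge0]), so [g >= 0] at height
    [0].  Two atoms of equal height whose [g]-values agree modulo [g u] differ
    by a multiple of [u], hence are equal ([atom_eq_mod]): there are at most
    [g u] atoms of each height.  So for every [n] there is a slope [C] with
    [g + C f >= 0] on the atoms of height at most [n], and this inequality
    passes to their sums, that is, to the atomic elements of height at most [n]
    ([atomic_bounded_below]).

    Now let [b + m] be atomic for every [m] in [M].  Translating by [b] shows
    that [g] is bounded below on all the elements of [M] of height at most [n].
    Then, for [D] large, [g + D f] is an additive map that is positive on the
    nonzero elements of height at most [n]; it bounds the number of summands
    in the decompositions of an element of height [n], which is therefore
    atomic. *)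

Set Implicit Arguments.
Unset Strict Implicit.
Unset Printing Implicit Defensive.
Import Order.TTheory GRing.Theory Num.Theory.
Local Open Scope classical_set_scope.
Local Open Scope ring_scope.

(** * Decompositions controlled by a positive additive map *)

Section Submonoids.
Variables (V : nmodType) (M : set V).
Hypothesis subM : submonoid M.

Lemma submonoid0 : M 0.
Proof. by case: subM => /set_mem. Qed.

Lemma submonoidD x y : M x -> M y -> M (x + y).
Proof. by case: subM => _ MD Mx My; apply/set_mem/MD; apply/mem_set. Qed.

Lemma submonoidMn x n : M x -> M (x *+ n).
Proof.
move=> Mx; elim: n => [|n IHn]; first by rewrite mulr0n; apply: submonoid0.
by rewrite mulrS; apply: submonoidD.
Qed.

Lemma invertibles0 : invertibles M 0.
Proof. by split; [|exists 0; rewrite ?addr0 //]; exact: submonoid0. Qed.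

Lemma invertibles_Dl r s : M r -> M s -> invertibles M (r + s) ->
  invertibles M r.
Proof.
move=> Mr Ms [_ [y My rsy0]]; split=> //; exists (s + y); last by rewrite addrA.
exact: submonoidD.
Qed.

Lemma atomic_elementsD x y :
  atomic_elements M x -> atomic_elements M y -> atomic_elements M (x + y).
Proof.
move=> [Mx nx [s sP xE]] [My _ [t tP yE]]; split.
- exact: submonoidD.
- by move=> /(invertibles_Dl Mx My).
- exists (s ++ t); last by rewrite big_cat /= -xE -yE.
  by move=> a; rewrite mem_cat => /orP[]; auto.
Qed.

(** An additive map that is positive on the noninvertible summands of [x]
    decreases strictly each time that [x] is split, so that splitting must
    end, in atoms.  Positivity is asked only of the summands of one element
    because the map used in the main argument depends on [x]. *)
Lemma atomic_elements_positive (h : V -> int) x :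
    {morph h : r s / r + s} ->
    (forall r s, M r -> M s -> x = r + s -> ~ invertibles M r -> 0 < h r) ->
  M x -> ~ invertibles M x -> atomic_elements M x.
Proof.
move=> hD; have [n] := ubnP `|h x|%N; elim: n x => // n IHn x ltn hpos Mx nx.
have [ax|nax] := pselect (atoms M x).
  split=> //; exists [:: x]; last by rewrite big_seq1.
  by move=> a; rewrite inE => /eqP ->.
have [r [s [Mr Ms xE nr ns]]] : exists r s,
    [/\ M r, M s, x = r + s, ~ invertibles M r & ~ invertibles M s].
  apply: contrapT => nsplit; apply: nax; split=> // r s Mr Ms xE.
  have [|nr] := pselect (invertibles M r); first by left.
  have [|ns] := pselect (invertibles M s); first by right.
  by case: nsplit; exists r, s.
have xE' : x = s + r by rewrite addrC.
have hr := hpos _ _ Mr Ms xE nr; have hs := hpos _ _ Ms Mr xE' ns.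
have hx : h x = h r + h s by rewrite xE hD.
rewrite [X in atomic_elements M X]xE; apply: atomic_elementsD; apply: IHn => //.
- by lia.
- move=> r1 r2 M1 M2 rE; apply: (hpos r1 (r2 + s)) => //.
    exact: submonoidD.
  by rewrite addrA -rE.
- by lia.
- move=> r1 r2 M1 M2 sE; apply: (hpos r1 (r2 + r)) => //.
    exact: submonoidD.
  by rewrite addrA -sE.
Qed.

End Submonoids.

(** * Submonoids with a nonnegative height *)

Section HeightAndCoordinate.
Variables (V : zmodType) (M : set V) (f g : {additive V -> int}).
Hypothesis subM : submonoid M.
Hypothesis f_ge0 : forall x, M x -> 0 <= f x.
Hypothesis fg_inj : forall x, f x = 0 -> g x = 0 -> x = 0.

Lemma invertible_height0 x : invertibles M x -> f x = 0.
Proof.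
move=> [Mx [y My /(congr1 f)]]; rewrite raddfD raddf0.
by have := f_ge0 Mx; have := f_ge0 My; lia.
Qed.

Lemma atomic_of_height0_invertible :
  (forall x, M x -> f x = 0 -> invertibles M x) -> atomic M.
Proof.
move=> inv0 x Mx nx; apply: (@atomic_elements_positive _ _ subM f) => //.
  exact: raddfD.
move=> r s Mr Ms _ nr; rewrite lt_def f_ge0 // andbT.
by apply/eqP => /(inv0 _ Mr).
Qed.

Section NoninvertibleHeight0.
Variable u : V.
Hypotheses (Mu : M u) (nu : ~ invertibles M u) (fu : f u = 0) (gu : 0 < g u).

(** If [g v < 0], then the combination of [u] and [v] with coefficients
    [- g v] and [g u] is killed by [f] and [g], hence is [0], and contains
    [u] at least once. *)
Lemma height0_ge0 v : M v -> f v = 0 -> 0 <= g v.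
Proof.
move=> Mv fv; rewrite leNgt; apply/negP => gv; apply: nu; split=> //.
exists (u *+ `|g v|.-1 + v *+ `|g u|).
  by apply: submonoidD => //; apply: submonoidMn.
rewrite addrA -mulrS prednK; last by lia.
apply: fg_inj; rewrite raddfD !raddfMn ?fu ?fv /=; first by rewrite !mul0rn.
by rewrite -mulr_natr natz -mulr_natr natz !abszE ltr0_norm // gtr0_norm //; ring.
Qed.

Lemma height0_gt0 v : M v -> f v = 0 -> v != 0 -> 0 < g v.
Proof.
move=> Mv fv; rewrite lt_def height0_ge0 // andbT.
by apply: contraNN => /eqP gv; apply/eqP/fg_inj.
Qed.

Lemma invertible_eq0 v : invertibles M v -> v = 0.
Proof.
move=> iv; apply: fg_inj; first exact: invertible_height0.
have fv := invertible_height0 iv; case: iv => Mv [w Mw vw0].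
have fw : f w = 0 by move/(congr1 f): vw0; rewrite raddfD raddf0 fv add0r.
move/(congr1 g): vw0; rewrite raddfD raddf0.
by have := height0_ge0 Mv fv; have := height0_ge0 Mw fw; lia.
Qed.

(** The atom with the larger coordinate is the sum of the other one and of a
    multiple of [u], so this multiple is [0]. *)
Lemma atom_eq_mod a a' : atoms M a -> atoms M a' -> f a = f a' ->
  (g a = g a' %[mod g u])%Z -> a = a'.
Proof.
wlog le_g : a a' / g a' <= g a.
  move=> W Aa Aa' fE gE; case: (leP (g a') (g a)) => [|/ltW] le_g; first exact: W.
  by by apply/esym/W.
move=> [Ma na ia] [Ma' na' _] fE /eqP; rewrite eqz_mod_dvd => /dvdzP[k kE].
have k0 : 0 <= k by rewrite -(pmulr_lge0 _ gu) -kE subr_ge0.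
have aE : a = a' + u *+ `|k|.
  apply/eqP; rewrite -subr_eq0 opprD addrA; apply/eqP/fg_inj.
    by rewrite !raddfB raddfMn /= fu mul0rn fE subrr subr0.
  by rewrite !raddfB raddfMn /= kE -mulr_natr natz abszE ger0_norm //; ring.
have [//|/invertible_eq0 u0] := ia _ _ Ma' (submonoidMn subM `|k| Mu) aE.
by rewrite aE u0 addr0.
Qed.

(** There are finitely many pairs of a height and a residue modulo [g u], and
    each of them is that of at most one atom. *)
Lemma atoms_bounded_below n : exists B : nat,
  forall a, atoms M a -> f a <= n%:Z -> - B%:Z <= g a.
Proof.
pose I : finType := ('I_n.+1 * 'I_`|g u|)%type.
pose class (i : I) a := f a = i.1%:Z /\ (g a %% g u)%Z = i.2%:Z.
have /choice[B BP] : forall i : I, exists B : nat,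
    forall a, atoms M a -> class i a -> - B%:Z <= g a.
  move=> i; have [[a [Aa [fa ga]]]|nA] := pselect (exists a, atoms M a /\ class i a).
    exists `|g a|%N => a' Aa' [fa' ga'].
    by rewrite -(@atom_eq_mod a a') // ?fa ?fa' ?ga ?ga' //; lia.
  by exists 0%N => a Aa ca; case: nA; exists a.
exists (\max_i B i) => a Aa fan.
have fa0 : 0 <= f a by apply: f_ge0; case: Aa.
have hf : (`|f a| < n.+1)%N by lia.
have gu0 : g u != 0 by rewrite gt_eqF.
have m0 := modz_ge0 (g a) gu0; have mlt := ltz_pmod (g a) gu.
have hg : (`|(g a %% g u)%Z| < `|g u|)%N by lia.
pose i : I := (Ordinal hf, Ordinal hg).
have Bi : - (B i)%:Z <= g a by apply: BP => //; split=> /=; lia.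
by have := leq_bigmax (F := B) i; lia.
Qed.

(** A lower bound [- B] for atoms is turned into the additive inequality
    [0 <= g + C f], which, unlike a constant bound, is stable under sums; at
    height [0] it is the positivity of [g]. *)
Lemma atomic_bounded_below n : exists C : nat,
  forall x, atomic_elements M x -> f x <= n%:Z -> 0 <= g x + C%:Z * f x.
Proof.
have [C CP] := atoms_bounded_below n; exists C => x [_ _ [s sA ->]] {x}.
elim: s sA => [|a s IHs] sA; first by rewrite big_nil !raddf0 mulr0.
have sA' : forall b, b \in s -> atoms M b.
  by move=> b bs; apply: sA; rewrite inE bs orbT.
have Aa : atoms M a by apply: sA; rewrite inE eqxx.
have Ma : M a by case: Aa.
have fs : 0 <= f (\sum_(b <- s) b).
  rewrite raddf_sum big_seq; apply: sumr_ge0 => b /sA'[Mb _ _]; exact: f_ge0.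
have fa := f_ge0 Ma; rewrite big_cons !raddfD /= => fle.
have {IHs} gs : 0 <= g (\sum_(b <- s) b) + C%:Z * f (\sum_(b <- s) b).
  by apply: IHs => //; apply: le_trans fle; rewrite lerDr.
have ga : 0 <= g a + C%:Z * f a.
  have [fa0|fa0] := eqVneq (f a) 0.
    by rewrite fa0 mulr0 addr0; apply: height0_ge0.
  have : - C%:Z <= g a by apply: CP => //; apply: le_trans fle; rewrite lerDl.
  by nia.
by rewrite mulrDr addrACA addr_ge0.
Qed.

Lemma atomic_of_noninvertible_height0 : nearly_atomic M -> atomic M.
Proof.
move=> [b Mb bP] x Mx nx.
have fx := f_ge0 Mx; have fb := f_ge0 Mb.
have [C CP] := atomic_bounded_below `|f b + f x|.
(* Applied to [b + m], the slope [C] gives [g m > - D] up to height [f x]. *)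
pose D : int := `|g b| + C%:Z * (f b + f x) + 1.
pose h y := g y + D * f y.
apply: (@atomic_elements_positive _ _ subM h) => // [y z|m s Mm Ms xE nm].
  by rewrite /h !raddfD /=; ring.
have fm := f_ge0 Mm; have fs := f_ge0 Ms.
have fms : f x = f m + f s by rewrite xE raddfD.
rewrite /h; have [fm0|fm0] := eqVneq (f m) 0.
  rewrite fm0 mulr0 addr0; apply: height0_gt0 => //.
  apply/eqP => m0; apply: nm; rewrite m0; exact: invertibles0.
have gbm : 0 <= g b + g m + C%:Z * (f b + f m).
  by have := CP _ (bP _ Mm); rewrite !raddfD /=; apply; lia.
have gm : 0 < g m + D by rewrite /D; nia.
have D0 : 0 <= D by rewrite /D; nia.
by nia.
Qed.

End NoninvertibleHeight0.
End HeightAndCoordinate.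

Lemma nearly_atomic_atomic (V : zmodType) (M : set V) (f g : {additive V -> int}) :
    submonoid M -> (forall x, M x -> 0 <= f x) ->
    (forall x, f x = 0 -> g x = 0 -> x = 0) ->
  nearly_atomic M -> atomic M.
Proof.
move=> subM f_ge0 fg_inj nearM.
have [inv0|] := pselect (forall x, M x -> f x = 0 -> invertibles M x).
  exact: (atomic_of_height0_invertible subM f_ge0 inv0).
move=> /existsNP[u /not_implyP[Mu /not_implyP[fu nu]]].
have [gu|gu|gu] := ltgtP (g u) 0.
- apply: (@atomic_of_noninvertible_height0 V M f (\- g) _ _ _ u) => //=.
    by move=> x fx /eqP; rewrite oppr_eq0 => /eqP; apply: fg_inj.
  by rewrite oppr_gt0.
- exact: (@atomic_of_noninvertible_height0 V M f g _ _ _ u).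
- case: nu; rewrite (fg_inj u fu gu); exact: invertibles0.
Qed.

(** * From a rational supporting line to an integer height *)

Definition int_form (p q : int) (m : int * int) : int := p * m.1 + q * m.2.

Lemma int_form_is_zmod_morphism p q : zmod_morphism (int_form p q).
Proof. by move=> x y; rewrite /int_form /=; ring. Qed.

HB.instance Definition _ p q :=
  GRing.isZmodMorphism.Build (int * int)%type int (int_form p q)
    (int_form_is_zmod_morphism p q).

(** A line of rational slope is the kernel of an integer form; the real form
    that defines the half-plane has the same kernel, so it is a real multiple
    of the integer one, and the sign of the multiplier decides between the
    integer form and its opposite. *)
Lemma rationally_supported_int_form (R : realType) (M : set (int * int)) :
  rationally_supported R M ->
  exists p q : int, (p, q) != (0, 0) /\ forall m, M m -> 0 <= int_form p q m.
Proof.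
move=> [L [a [b [ab0 LE supp]]] slope].
have [p [q [c [pq0 aE bE]]]] : exists p q : int, exists c : R,
    [/\ (p, q) != (0, 0), a = c * p%:~R & b = c * q%:~R].
  case: slope => [LE'|[q LE']].
    have : L (0, 1) by rewrite LE'.
    rewrite LE /= mulr0 add0r mulr1 => b0.
    by exists 1, 0, a; rewrite b0 mulr0 mulr1.
  have : L (1, ratr q) by rewrite LE' /= mulr1.
  rewrite LE /= mulr1 => abq.
  have d0 : (denq q)%:~R != 0 :> R by rewrite intr_eq0 denq_neq0.
  exists (- numq q), (denq q), (b / (denq q)%:~R); split.
  - by rewrite xpair_eqE negb_and denq_neq0 orbT.
  - rewrite (_ : a = - (b * ratr q)); last by lra.
    by rewrite /ratr rmorphN; field.
  - by field.
have formE (m : int * int) :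
    a * m.1%:~R + b * m.2%:~R = c * (int_form p q m)%:~R.
  by rewrite aE bE /int_form rmorphD !rmorphM /=; ring.
have c0 : c != 0.
  by apply: contraNneq ab0 => c0; rewrite aE bE c0 !mul0r.
have orient (e : R) : e != 0 ->
    (forall m, M m -> 0 <= e * (int_form p q m)%:~R) ->
    exists p q : int, (p, q) != (0, 0) /\ forall m, M m -> 0 <= int_form p q m.
  move=> e0 posM; have [e_lt0|e_gt0|/eqP] := ltgtP e 0; last by rewrite (negPf e0).
    exists (- p), (- q); split.
      by move: pq0; rewrite !xpair_eqE !oppr_eq0.
    move=> m Mm; move: (posM m Mm); rewrite nmulr_rge0 // lerz0.
    by rewrite /int_form; lia.
  by exists p, q; split=> // m Mm; move: (posM m Mm); rewrite pmulr_rge0 // ler0z.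
case: supp => supp; [apply: (orient c)|apply: (orient (- c))];
  rewrite ?oppr_eq0 // => m Mm;
  have := supp _ (ex_intro2 _ _ m Mm erefl); rewrite /= formE //.
by rewrite mulNr oppr_ge0.
Qed.

Theorem theorem4p3 (R : realType) (M : set (int * int)) :
  submonoid M -> rationally_supported R M -> nearly_atomic M -> atomic M.
Proof.
move=> subM /rationally_supported_int_form[p [q [pq0 f_ge0]]].
apply: (@nearly_atomic_atomic _ M (int_form p q) (int_form (- q) p)) => //.
(* Joint injectivity: the two forms have determinant [p ^ 2 + q ^ 2]. *)
move=> [x y] /=; rewrite /int_form /= => f0 g0.
have pq : p ^+ 2 + q ^+ 2 != 0.
  by apply: contraNneq pq0 => pq; rewrite xpair_eqE; apply/andP; nia.
have xE : (p ^+ 2 + q ^+ 2) * x = 0.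
  transitivity (p * (p * x + q * y) - q * (- q * x + p * y)); first by ring.
  by rewrite f0 g0 !mulr0 subrr.
have yE : (p ^+ 2 + q ^+ 2) * y = 0.
  transitivity (q * (p * x + q * y) + p * (- q * x + p * y)); first by ring.
  by rewrite f0 g0 !mulr0 addr0.
by move: xE yE => /eqP + /eqP; rewrite !mulf_eq0 (negPf pq) => /eqP -> /eqP ->.
Qed.
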